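(* There is an explicit diffeomorphism $\Theta:\mathbb S^3\to\mathbb S^3$ such that $$\mathbf P^*g_F=\Theta^*(8r_*^2\,g_4).$$ Consequently, the Riemannian manifolds $(\mathbb S^3,\mathbf P^*g_F)$ and $(\mathbb S^3,8r_*^2g_4)$ are isometric.
   Context: $\mathbb S^3$ is the group of unit quaternions $q=X_1+X_2\mathrm i+X_3\mathrm j+X_4\mathrm k$, identified with the unit sphere in $\mathbb R^4$, with round metric $g_{\mathrm r}$. For $q\in\mathbb S^3$, $\mathbf R_q\in\mathrm{SO}(3)$ is $\mathbf R_qv=qv\overline q$ for $v\in\operatorname{Im}\mathbb H\cong\mathbb R^3$ (via $x\mathrm i+y\mathrm j+z\mathrm k\leftrightarrow(x,y,z)^{\mathrm T}$). Fix $r_*>0$, $\mathbf D=r_*\operatorname{diag}(1,-1,0)$, and $\mathcal N_{\mathrm b}=\{\mathbf R\mathbf D\mathbf R^{\mathrm T}:\mathbf R\in\mathrm{SO}(3)\}$, a submanifold of the space of traceless symmetric $3\times3$ real matrices; $g_F$ is the metric induced on $\mathcal N_{\mathrm b}$ by the Frobenius inner product $\langle\mathbf A,\mathbf B\rangle_F=\operatorname{tr}(\mathbf A\mathbf B)$. The map $\mathbf P:\mathbb S^3\to\mathcal N_{\mathrm b}$ is $\mathbf P(q)=\mathbf R_q\mathbf D\mathbf R_q^{\mathrm T}$. The Hopf field is $V_{\mathrm H}(X)=(-X_2,X_1,-X_4,X_3)$ and the Berger metric is $g_4(U,W)=g_{\mathrm r}(U,W)+3g_{\mathrm r}(U,V_{\mathrm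 H})g_{\mathrm r}(W,V_{\mathrm H})$. *)

(* Defs.v *)
From HB Require Import structures.
From mathcomp Require Import all_boot all_order all_algebra.
From mathcomp Require Import all_classical all_reals all_analysis.

Set Implicit Arguments.
Unset Strict Implicit.
Unset Printing Implicit Defensive.

Import Order.TTheory GRing.Theory Num.Theory.
Import numFieldNormedType.Exports.

Local Open Scope classical_set_scope.
Local Open Scope ring_scope.

(* Differential geometry of submanifolds M of a finite-dimensional ambient
   space V.  Maps, vector fields and metrics are total functions on the ambient
   space; only their values on M (and on its tangent vectors) are meaningful. *)

(* f is C^k on the open set U, i.e. all iterated directional derivatives of
   order <= k exist and are continuous on U *)
Fixpoint is_Ck (R : realType) (V W : normedModType R) (k : nat) (U : set V)
    (f : V -> W) : Prop :=
  match k with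
  | 0%N => forall x, U x -> {for x, continuous f}
  | k'.+1 => (forall x, U x -> differentiable f x)
             /\ forall v : V, is_Ck k' U ('D_v f)
  end.

Definition is_Cinf (R : realType) (V W : normedModType R) (U : set V)
  (f : V -> W) : Prop := forall k, is_Ck k U f.

Definition smooth_on (R : realType) (V W : normedModType R) (M : set V)
    (f : V -> W) : Prop :=
  forall p, M p -> exists (U : set V) (F : V -> W),
    [/\ open_nbhs p U, is_Cinf U F & forall x, M x -> U x -> F x = f x].

Definition smooth_map (R : realType) (V W : normedModType R) (M : set V)
  (N : set W) (f : V -> W) : Prop := set_fun M N f /\ smooth_on M f.

Definition diffeomorphism (R : realType) (V W : normedModType R) (M : set V)
    (N : set W) (f : V -> W) : Prop :=
  smooth_map M N f /\ exists g : W -> V,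
    [/\ smooth_map N M g, forall x, M x -> g (f x) = x
      & forall y, N y -> f (g y) = y].

Definition curve_through (R : realType) (V : normedModType R) (M : set V)
    (p v : V) (c : R -> V) : Prop :=
  (exists I : set R,
     [/\ open_nbhs 0 I, is_Cinf (V := R^o) I c & forall t, I t -> M (c t)])
  /\ c 0 = p /\ is_derive (0 : R^o) 1 c v.

Definition tangent (R : realType) (V : normedModType R) (M : set V) (p : V)
  : set V := [set v | exists c, curve_through M p v c].

(* (dF)_p v is the velocity at 0 of F \o c, for any smooth curve c in M with
   c(0) = p and c'(0) = v; for F smooth on M this does not depend on c. *)
Definition tangent_map (R : realType) (V W : normedModType R) (M : set V)
    (F : V -> W) (p v : V) : W :=
  xget 0 [set w | exists2 c : R -> V,
    curve_through M p v c & is_derive (0 : R^o) 1 (F \o c) w].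

(* A field of forms: g p u w is the value at p on u, w in T_p M. *)
Definition form_field (R : realType) (V : normedModType R) := V -> V -> V -> R.

Definition eq_form_on (R : realType) (V : normedModType R) (M : set V)
    (g h : form_field V) : Prop :=
  forall p u w, M p -> tangent M p u -> tangent M p w -> g p u w = h p u w.

Definition scale_form (R : realType) (V : normedModType R) (a : R)
  (g : form_field V) : form_field V := fun p u w => a * g p u w.

Definition pullback (R : realType) (V W : normedModType R) (M : set V)
    (F : V -> W) (h : form_field W) : form_field V :=
  fun p u w => h (F p) (tangent_map M F p u) (tangent_map M F p w).

(* The form field induced on M by an ambient inner product; it has the junk
   value 0 away from points of M and vectors tangent to M. *)
Definition induced_form (R : realType) (V : normedModType R) (M : set V)
    (ip : V -> V -> R) : form_field V :=
  fun p u w => if `[< [/\ M p, tangent M p u & tangent M p w] >]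
               then ip u w else 0.

Definition vector_field (R : realType) (V : normedModType R) (M : set V)
    (X : V -> V) : Prop :=
  smooth_on M X /\ forall p, M p -> tangent M p (X p).

Definition riemannian_metric (R : realType) (V : normedModType R) (M : set V)
    (g : form_field V) : Prop :=
  [/\ forall p u w, M p -> tangent M p u -> tangent M p w ->
        g p u w = g p w u,
      forall p a u v w, M p ->
        tangent M p u -> tangent M p v -> tangent M p w ->
        g p (a *: u + v) w = a * g p u w + g p v w,
      forall p u, M p -> tangent M p u -> u != 0 -> 0 < g p u u
    & forall X Y, vector_field M X -> vector_field M Y ->
        smooth_on (W := R^o) M (fun p => g p (X p) (Y p))].

Definition riemannian_isometric (R : realType) (V W : normedModType R)
    (M : set V) (g : form_field V) (N : set W) (h : form_field W) : Prop :=
  [/\ riemannian_metric M g, riemannian_metric N h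
    & exists2 F : V -> W,
        diffeomorphism M N F & eq_form_on M g (pullback M F h)].

(* The quaternion X_1 + X_2 i + X_3 j + X_4 k is the row vector
   (X_1, X_2, X_3, X_4), with entries indexed by 0, 1, 2, 3 : 'I_4. *)
Definition row4 (R : realType) (a b c d : R) : 'rV[R]_4 :=
  \row_(i < 4) [:: a; b; c; d]`_i.

Definition qmul (R : realType) (p q : 'rV[R]_4) : 'rV[R]_4 :=
  row4
    (p 0 0 * q 0 0 - p 0 1 * q 0 1 - p 0 2 * q 0 2 - p 0 3 * q 0 3)
    (p 0 0 * q 0 1 + p 0 1 * q 0 0 + p 0 2 * q 0 3 - p 0 3 * q 0 2)
    (p 0 0 * q 0 2 - p 0 1 * q 0 3 + p 0 2 * q 0 0 + p 0 3 * q 0 1)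
    (p 0 0 * q 0 3 + p 0 1 * q 0 2 - p 0 2 * q 0 1 + p 0 3 * q 0 0).

Definition qconj (R : realType) (q : 'rV[R]_4) : 'rV[R]_4 :=
  row4 (q 0 0) (- q 0 1) (- q 0 2) (- q 0 3).

Definition im_quat (R : realType) (v : 'cV[R]_3) : 'rV[R]_4 :=
  row4 0 (v 0 0) (v 1 0) (v 2 0).

Definition quat_im (R : realType) (q : 'rV[R]_4) : 'cV[R]_3 :=
  \col_(i < 3) [:: q 0 1; q 0 2; q 0 3]`_i.

Definition dot4 (R : realType) (u w : 'rV[R]_4) : R :=
  \sum_(i < 4) u 0 i * w 0 i.

Definition sphere3 (R : realType) : set 'rV[R]_4 := [set q | dot4 q q = 1].
Arguments sphere3 R : clear implicits.

Definition round_metric (R : realType) : form_field 'rV[R]_4 :=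
  induced_form (sphere3 R) (@dot4 R).
Arguments round_metric R : clear implicits.

(* The matrix, in the canonical basis, of v |-> q v \overline{q} on Im H. *)
Definition rotation_of (R : realType) (q : 'rV[R]_4) : 'M[R]_3 :=
  \matrix_(i < 3, j < 3)
    quat_im (qmul (qmul q (im_quat (delta_mx j 0))) (qconj q)) i 0.

Definition SO3 (R : realType) : set 'M[R]_3 :=
  [set A | A *m A^T = 1%:M /\ \det A = 1].
Arguments SO3 R : clear implicits.

Definition Dmx (R : realType) (r : R) : 'M[R]_3 :=
  r *: diag_mx (\row_(i < 3) [:: 1; -1; 0]`_i).

Definition Nb (R : realType) (r : R) : set 'M[R]_3 :=
  [set A | exists2 Q, SO3 R Q & A = Q *m Dmx r *m Q^T].

Definition frobenius_metric (R : realType) (r : R) : form_field 'M[R]_3 :=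
  induced_form (Nb r) (fun A B => \tr (A *m B)).

Definition Pmap (R : realType) (r : R) (q : 'rV[R]_4) : 'M[R]_3 :=
  rotation_of q *m Dmx r *m (rotation_of q)^T.

Definition hopf_field (R : realType) (X : 'rV[R]_4) : 'rV[R]_4 :=
  row4 (- X 0 1) (X 0 0) (- X 0 3) (X 0 2).

Definition berger_metric (R : realType) : form_field 'rV[R]_4 :=
  fun p u w => round_metric R p u w
    + 3 * round_metric R p u (hopf_field p) * round_metric R p w (hopf_field p).
Arguments berger_metric R : clear implicits.

(* Main.v *)
(* Write a tangent vector at q as q v with v = x i + y j + z k imaginary.  Since
   the derivative of R_q along q v is R_q ad2(v), with ad2(v) the matrix of
   w |-> v w - w v, one gets dP(q v) = R_q [ad2(v), D] R_q^T, whose squared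
   Frobenius norm is 8 r^2 (x^2 + y^2 + 4 z^2).  So P^* g_F is 8 r^2 times the
   round metric with the direction of the left-invariant field q k stretched.
   The involution exchanging the second and fourth coordinates is a linear
   isometry that carries q k to the Hopf field, so it can serve as Theta. *)
Require Import Defs.
From HB Require Import structures.
From mathcomp Require Import all_boot all_order all_algebra.
From mathcomp Require Import all_classical all_reals all_analysis.
From mathcomp Require Import ring.

Set Implicit Arguments.
Unset Strict Implicit.
Unset Printing Implicit Defensive.

Import Order.TTheory GRing.Theory Num.Theory.
Import numFieldNormedType.Exports.

Local Open Scope classical_set_scope.
Local Open Scope ring_scope.

(** * Closure properties of $C^k$ maps on open sets *)

Section Smoothness.
Context {R : realType}.
Implicit Types V W : normedModType R.

(** The expansion of [f] at [x] with remainder $o(h)$ depends only on the germ of [f], so ['d f x]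
    also serves as the differential of [g]. *)
Lemma near_eq_differentiable V W (f g : V -> W) (x : V) :
  {near x, f =1 g} -> differentiable f x -> differentiable g x.
Proof.
move=> fg df; have fgx := nbhs_singleton fg.
have dfc : continuous ('d f x) by exact: diff_continuous.
have E : g \o shift x = cst (g x) + 'd f x +o_ (0 : V) id.
  have fg0 : \forall y \near (0 : V), f (shift x y) = g (shift x y).
    by move: fg; rewrite (near_shift 0)/= subr0.
  apply: eqaddoE; apply/eqaddoP => e e0.
  have /eqaddoP/(_ e e0) := diff_locally df; apply: filterS2 fg0 => y /=.
  by rewrite !fctE/= fgx => ->.
by apply/diff_locallyP; rewrite (diff_unique dfc E).
Qed.

Lemma open_near_eq V (T : Type) (U : set V) (f g : V -> T) x :
  open U -> U x -> (forall y, U y -> f y = g y) -> {near x, f =1 g}.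
Proof.
by move=> oU Ux fg; apply: filterS (open_nbhs_nbhs (conj oU Ux)) => y /fg.
Qed.

(** Derivative formulas hold only on [U], while functions are total. As [U] is open, agreement on it
    is agreement of germs and so passes to every directional derivative. *)
Lemma is_Ck_ext V W k (U : set V) (f g : V -> W) : open U ->
  (forall x, U x -> f x = g x) -> is_Ck k U f -> is_Ck k U g.
Proof.
move=> oU; elim: k f g => [|k IH] f g fg /=.
  move=> cf x Ux; have nfg := open_near_eq oU Ux fg.
  suff: g @ x --> f x by rewrite fg.
  exact: cvg_trans (near_eq_cvg nfg) (cf x Ux).
move=> [df Df]; split=> [x Ux|v].
  exact: near_eq_differentiable (open_near_eq oU Ux fg) (df x Ux).
apply: IH (Df v) => x Ux; apply: near_eq_derive.
exact: open_near_eq oU Ux fg.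
Qed.

Lemma is_CkW V W k (U : set V) (f : V -> W) : is_Ck k.+1 U f -> is_Ck k U f.
Proof.
elim: k f => [|k IH] f [df Df].
  by move=> x Ux; exact: differentiable_continuous (df x Ux).
by split=> // v; apply: IH.
Qed.

Lemma is_Ck_cst V W k (U : set V) (c : W) : is_Ck k U (cst c : V -> W).
Proof.
elim: k c => [|k IH] c /=; first by move=> x _; exact: cst_continuous.
split=> [x _|v]; first exact: differentiable_cst.
rewrite (_ : 'D_v _ = cst 0)//.
by apply/funext => x; exact: derive_cst.
Qed.

Lemma is_CkD V W k (U : set V) (f g : V -> W) : open U ->
  is_Ck k U f -> is_Ck k U g -> is_Ck k U (fun x => f x + g x).
Proof.
move=> oU; elim: k f g => [|k IH] f g /=.
  by move=> cf cg x Ux; apply: continuousD; [exact: cf|exact: cg].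
move=> [df Df] [dg Dg]; split=> [x Ux|v].
  by apply: differentiableD; [exact: df|exact: dg].
apply: is_Ck_ext (IH _ _ (Df v) (Dg v)) => //= x Ux; rewrite -deriveD//.
  exact/diff_derivable/df.
exact/diff_derivable/dg.
Qed.

Lemma is_CkM V k (U : set V) (f g : V -> R^o) : open U ->
  is_Ck k U f -> is_Ck k U g -> is_Ck (W := R^o) k U (fun x => f x * g x).
Proof.
move=> oU; elim: k f g => [|k IH] f g.
  by move=> cf cg x Ux; apply: continuousM; [exact: cf|exact: cg].
move=> cf cg; have [df Df] := cf; have [dg Dg] := cg; split=> [x Ux|v].
  by apply: differentiableM; [exact: df|exact: dg].
(* Leibniz rule. The undifferentiated factors are $C^{k+1}$ and are lowered to $C^k$ by [is_CkW]
   before the induction hypothesis applies. *)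
pose h := (f \* 'D_v g) \+ (g \* 'D_v f).
apply: (@is_Ck_ext _ _ _ _ (h : V -> R^o)) => //= [x Ux|].
  rewrite (@deriveM _ _ f g)//; first exact/diff_derivable/df.
  exact/diff_derivable/dg.
apply: is_CkD => //; apply: IH.
- exact: is_CkW.
- exact: Dg.
- exact: is_CkW.
- exact: Df.
Qed.

(** A continuous linear map is its own differential, so it commutes with ['D_v]. Coordinates,
    negation and scaling of a fixed vector are instances. *)
Lemma is_Ck_linear V W W' k (U : set V) (L : W -> W') (f : V -> W) :
  linear L -> continuous L -> open U -> is_Ck k U f -> is_Ck k U (L \o f).
Proof.
move=> linL cL oU.
pose LB := GRing.isLinear.Build _ _ _ _ L linL.
pose LL : {linear W -> W'} := HB.pack L LB.
have dL y : differentiable L y := @linear_differentiable _ _ _ LL y cL.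
elim: k f => [|k IH] f.
  move=> cf x Ux; apply: continuous_comp; first exact: cf.
  exact: (cL (f x)).
move=> [df Df]; split=> [x Ux|v].
  by apply: differentiable_comp; [exact: df|exact: dL].
apply: is_Ck_ext (IH _ (Df v)) => //= x Ux.
have dfx := df x Ux.
have dLf : differentiable (L \o f) x by exact: differentiable_comp.
rewrite /= (deriveE _ dfx) (deriveE _ dLf) (diff_comp dfx (dL (f x)))/=.
by rewrite (@diff_lin _ _ _ LL).
Qed.

Lemma is_Ck_id V k (U : set V) : is_Ck k U (id : V -> V).
Proof.
case: k => [|k]; first by move=> x _; exact: cvg_id.
split=> [x _|v]; first exact: ex_diff.
rewrite (_ : 'D_v _ = cst v); last by apply/funext => x; exact: derive_id.
exact: is_Ck_cst.
Qed.

Lemma is_Ck_subset V W k (U U' : set V) (f : V -> W) :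
  U' `<=` U -> is_Ck k U f -> is_Ck k U' f.
Proof.
move=> UU; elim: k f => [|k IH] f.
  by move=> cf x Ux; exact: (cf x (UU x Ux)).
move=> [df Df]; split=> [x Ux|v]; first exact: (df x (UU x Ux)).
exact: IH (Df v).
Qed.

Lemma is_CkN V k (U : set V) (f : V -> R^o) : open U ->
  is_Ck k U f -> is_Ck (W := R^o) k U (fun x => - f x).
Proof.
move=> oU cf; apply: (@is_Ck_linear _ _ _ _ _ (-%R : R^o -> R^o)) => //.
- by move=> a x y; rewrite opprD scalerN.
- by move=> x; exact: opp_continuous.
Qed.

Lemma is_Ck_sum V W k (U : set V) (I : Type) (s : seq I) (F : I -> V -> W) :
  open U -> (forall i, is_Ck k U (F i)) ->
  is_Ck k U (fun x => \sum_(i <- s) F i x).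
Proof.
move=> oU cF; elim: s => [|i s IH].
  rewrite (_ : (fun _ => _) = cst 0); first exact: is_Ck_cst.
  by apply/funext => x; rewrite big_nil.
rewrite (_ : (fun _ => _) = fun x => F i x + \sum_(j <- s) F j x).
  exact: is_CkD.
by apply/funext => x; rewrite big_cons.
Qed.

Lemma is_Ck_coord V m n k (U : set V) (f : V -> 'M[R]_(m, n)) i j : open U ->
  is_Ck k U f -> is_Ck (W := R^o) k U (fun x => f x i j).
Proof.
move=> oU.
apply: (@is_Ck_linear _ _ R^o _ _ (fun A : 'M[R]_(m, n) => A i j : R^o)) => //.
- by move=> a x y; rewrite !mxE.
- exact: coord_continuous.
Qed.

(** Expansion in the elementary matrices [delta_mx i j] writes [f] as a sum of continuous linear
    images of its entries. *)
Lemma is_Ck_mx V m n k (U : set V) (f : V -> 'M[R]_(m, n)) : open U ->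
  (forall i j, is_Ck (W := R^o) k U (fun x => f x i j)) -> is_Ck k U f.
Proof.
move=> oU cf.
rewrite (_ : f = fun x => \sum_i \sum_j f x i j *: delta_mx i j).
  apply: is_Ck_sum => // i; apply: is_Ck_sum => // j.
  apply: (@is_Ck_linear V R^o _ k U (fun a : R^o => a *: delta_mx i j)) => //.
  - by move=> a x y; rewrite scalerDl scalerA.
  - by move=> x; exact: scalel_continuous.
by apply/funext => x; exact: matrix_sum_delta.
Qed.

Lemma is_Ck_mulmx V m n p k (U : set V) (f : V -> 'M[R]_(m, n))
    (g : V -> 'M[R]_(n, p)) : open U ->
  is_Ck k U f -> is_Ck k U g -> is_Ck k U (fun x => f x *m g x).
Proof.
move=> oU cf cg; apply: is_Ck_mx => // i j.
rewrite (_ : (fun _ => _) = fun x => \sum_l (f x i l * g x l j : R^o)).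
  by apply: is_Ck_sum => // l; apply: is_CkM => //; exact: is_Ck_coord.
by apply/funext => x; rewrite mxE.
Qed.

Lemma is_Ck_trmx V m n k (U : set V) (f : V -> 'M[R]_(m, n)) : open U ->
  is_Ck k U f -> is_Ck k U (fun x => (f x)^T).
Proof.
move=> oU cf; apply: is_Ck_mx => // i j.
rewrite (_ : (fun _ => _) = fun x => f x j i); first exact: is_Ck_coord.
by apply/funext => x; rewrite mxE.
Qed.

End Smoothness.

(** * Entrywise derivatives of matrix-valued maps *)

Section MatrixDerivative.
Context {R : realType} {V : normedModType R}.

Lemma is_derive_mx m n (M : V -> 'M[R]_(m, n)) t v (dM : 'M[R]_(m, n)) :
  (forall i j, is_derive t v (fun x => M x i j : R^o) (dM i j)) ->
  is_derive t v M dM.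
Proof.
move=> H; have dMx : derivable M t v.
  by apply/derivable_mxP => i j; have [] := H i j.
apply: DeriveDef => //; rewrite derive_mx//; apply/matrixP => i j.
by rewrite mxE; have [_ <-] := H i j.
Qed.

Lemma is_derive_coord m n (M : V -> 'M[R]_(m, n)) t v (dM : 'M[R]_(m, n)) i j :
  is_derive t v M dM -> is_derive t v (fun x => M x i j : R^o) (dM i j).
Proof.
move=> [dMx <-]; rewrite derive_mx// mxE; apply: DeriveDef => //.
exact: (derivable_mxP M t v).1.
Qed.

Lemma is_derive_mul (f g : V -> R^o) t v (df dg : R) :
  is_derive t v f df -> is_derive t v g dg ->
  is_derive t v (fun x => f x * g x : R^o) (df * g t + f t * dg).
Proof.
move=> Hf Hg; apply: (is_derive_eq (is_deriveM Hf Hg)).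
by rewrite addrC /GRing.scale/= [g t * _]mulrC.
Qed.

Lemma is_derive_big (I : Type) (W : normedModType R) (s : seq I)
    (F : I -> V -> W) t v dF :
  (forall i, is_derive t v (F i) (dF i)) ->
  is_derive t v (fun x => \sum_(i <- s) F i x) (\sum_(i <- s) dF i).
Proof.
move=> H; elim: s => [|i s IH].
  rewrite (_ : (fun _ => _) = cst 0) ?big_nil; first exact: is_derive_cst.
  by apply/funext => x; rewrite big_nil.
rewrite (_ : (fun _ => _) = F i + fun x => \sum_(j <- s) F j x).
  by rewrite big_cons; exact: is_deriveD.
by apply/funext => x; rewrite big_cons.
Qed.

Lemma is_derive_mulmx m n p (A : V -> 'M[R]_(m, n)) (B : V -> 'M[R]_(n, p))
    t v (dA : 'M[R]_(m, n)) (dB : 'M[R]_(n, p)) :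
  is_derive t v A dA -> is_derive t v B dB ->
  is_derive t v (fun x => A x *m B x) (dA *m B t + A t *m dB).
Proof.
move=> HA HB; apply: is_derive_mx => i j.
rewrite (_ : (fun _ => _) = fun x => \sum_l (A x i l * B x l j : R^o)).
  rewrite !mxE -big_split/=.
  apply: (@is_derive_big _ R^o) => l.
  by apply: is_derive_mul; exact: is_derive_coord.
by apply/funext => x; rewrite mxE.
Qed.

Lemma is_derive_trmx m n (A : V -> 'M[R]_(m, n)) t v (dA : 'M[R]_(m, n)) :
  is_derive t v A dA -> is_derive t v (fun x => (A x)^T) dA^T.
Proof.
move=> HA; apply: is_derive_mx => i j; rewrite mxE.
rewrite (_ : (fun _ => _) = fun x => A x j i : R^o).
  exact: is_derive_coord.
by apply/funext => x; rewrite mxE.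
Qed.

End MatrixDerivative.


(** * Quaternion algebra and $3\times3$ rotation matrices *)

Section Quaternions.
Context {R : realType}.
Implicit Types (q u v w : 'rV[R]_4) (a b c d : R).

Lemma forall_ord4 (P : 'I_4 -> Prop) :
  P 0 -> P 1 -> P 2 -> P 3 -> forall i, P i.
Proof.
move=> P0 P1 P2 P3 [[|[|[|[|//]]]] lti].
- by rewrite (_ : Ordinal lti = 0)//; exact: val_inj.
- by rewrite (_ : Ordinal lti = 1)//; exact: val_inj.
- by rewrite (_ : Ordinal lti = 2)//; exact: val_inj.
- by rewrite (_ : Ordinal lti = 3)//; exact: val_inj.
Qed.

Lemma forall_ord3 (P : 'I_3 -> Prop) : P 0 -> P 1 -> P 2 -> forall i, P i.
Proof.
move=> P0 P1 P2 [[|[|[|//]]] lti].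
- by rewrite (_ : Ordinal lti = 0)//; exact: val_inj.
- by rewrite (_ : Ordinal lti = 1)//; exact: val_inj.
- by rewrite (_ : Ordinal lti = 2)//; exact: val_inj.
Qed.

Lemma row4E a b c d :
  ((row4 a b c d 0 0 = a) * (row4 a b c d 0 1 = b) *
   (row4 a b c d 0 2 = c) * (row4 a b c d 0 3 = d))%type.
Proof. by rewrite !mxE. Qed.

Lemma row4_eta q : q = row4 (q 0 0) (q 0 1) (q 0 2) (q 0 3).
Proof. by apply/rowP; apply: forall_ord4; rewrite row4E. Qed.

Lemma row4P q : exists a b c d, q = row4 a b c d.
Proof. by do 4!eexists; exact: row4_eta. Qed.

Lemma dot4E q u : dot4 q u =
  q 0 0 * u 0 0 + q 0 1 * u 0 1 + q 0 2 * u 0 2 + q 0 3 * u 0 3.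
Proof.
rewrite /dot4 !big_ord_recl big_ord0 addr0 !addrA.
by do ![congr (_ + _)]; congr (_ * _); congr (_ _ _); exact: val_inj.
Qed.

Lemma dot4C q u : dot4 q u = dot4 u q.
Proof. by rewrite !dot4E; ring. Qed.

Lemma dot4Dr q a u w : dot4 q (a *: u + w) = a * dot4 q u + dot4 q w.
Proof. by rewrite !dot4E !mxE; ring. Qed.

Lemma dot4_sqr a b q u : dot4 (a *: q + b *: u) (a *: q + b *: u) =
  a ^+ 2 * dot4 q q + 2 * a * b * dot4 q u + b ^+ 2 * dot4 u u.
Proof. by rewrite !dot4E !mxE; ring. Qed.

Lemma dot4_gt0 q : q != 0 -> 0 < dot4 q q.
Proof.
move=> q0; rewrite lt_neqAle eq_sym sumr_ge0 ?andbT; last first.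
  by move=> i _; rewrite -expr2 sqr_ge0.
apply: contra q0 => /eqP H; apply/eqP/rowP => i; rewrite mxE.
have /(_ i isT)/eqP : forall i, true -> q 0 i * q 0 i = 0.
  by apply/psumr_eq0P => // j _; rewrite -expr2 sqr_ge0.
by rewrite mulf_eq0 orbb => /eqP.
Qed.

Definition mx3 (l : seq (seq R)) : 'M[R]_3 :=
  \matrix_(i < 3, j < 3) (nth [::] l i)`_j.

Lemma eq_mx3 (A B : 'M[R]_3) :
  A 0 0 = B 0 0 -> A 0 1 = B 0 1 -> A 0 2 = B 0 2 ->
  A 1 0 = B 1 0 -> A 1 1 = B 1 1 -> A 1 2 = B 1 2 ->
  A 2 0 = B 2 0 -> A 2 1 = B 2 1 -> A 2 2 = B 2 2 -> A = B.
Proof. by move=> *; apply/matrixP; do 2!apply: forall_ord3. Qed.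

Lemma mulmx33E (A B : 'M[R]_3) i j : (A *m B) i j =
  A i 0 * B 0 j + A i 1 * B 1 j + A i 2 * B 2 j.
Proof.
rewrite mxE !big_ord_recl big_ord0 addr0 !addrA.
by do ![congr (_ + _)]; congr (_ * _); congr (fun_of_matrix _ _ _);
  exact: val_inj.
Qed.

Lemma mxtrace33E (A : 'M[R]_3) : \tr A = A 0 0 + A 1 1 + A 2 2.
Proof.
rewrite /mxtrace !big_ord_recl big_ord0 addr0 !addrA.
by do ![congr (_ + _)]; congr (fun_of_matrix _ _ _); exact: val_inj.
Qed.

Lemma det33E (A : 'M[R]_3) : \det A =
  A 0 0 * (A 1 1 * A 2 2 - A 1 2 * A 2 1)
  - A 0 1 * (A 1 0 * A 2 2 - A 1 2 * A 2 0)
  + A 0 2 * (A 1 0 * A 2 1 - A 1 1 * A 2 0).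
Proof.
(* Reading the entries through [inord] turns the lifted indices of the cofactors into numerals, so
   both sides offer [ring] the same atoms. *)
have -> : A = \matrix_(i < 3, j < 3) A (inord i) (inord j).
  by apply/matrixP => i j; rewrite mxE !inord_val.
rewrite (expand_det_row _ 0) !big_ord_recl big_ord0 /cofactor.
rewrite !(expand_det_row _ 0) !big_ord_recl !big_ord0 /cofactor !det_mx11.
by rewrite !mxE /= /bump/=; ring.
Qed.

Lemma qmul_row4 a b c d a' b' c' d' :
  qmul (row4 a b c d) (row4 a' b' c' d') =
  row4 (a * a' - b * b' - c * c' - d * d') (a * b' + b * a' + c * d' - d * c')
       (a * c' - b * d' + c * a' + d * b') (a * d' + b * c' - c * b' + d * a').
Proof. by rewrite /qmul !row4E. Qed.

Lemma qconj_row4 a b c d : qconj (row4 a b c d) = row4 a (- b) (- c) (- d).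
Proof. by rewrite /qconj !row4E. Qed.

Lemma row4D a b c d a' b' c' d' : row4 a b c d + row4 a' b' c' d' =
  row4 (a + a') (b + b') (c + c') (d + d').
Proof. by apply/rowP; apply: forall_ord4; rewrite mxE !row4E. Qed.

Lemma quat_imE q : ((quat_im q 0 0 = q 0 1) * (quat_im q 1 0 = q 0 2) *
  (quat_im q 2 0 = q 0 3))%type.
Proof. by rewrite !mxE. Qed.

Lemma im_delta : ((im_quat (delta_mx 0 0) = row4 0 1 0 0 :> 'rV[R]_4) *
 (im_quat (delta_mx 1 0) = row4 0 0 1 0 :> 'rV[R]_4) *
 (im_quat (delta_mx 2 0) = row4 0 0 0 1 :> 'rV[R]_4))%type.
Proof. by rewrite /im_quat !mxE /=. Qed.

(** The Euler-Rodrigues formula, a polynomial identity valid for every quaternion, unit or not. *)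
Lemma rotation_ofE a b c d : rotation_of (row4 a b c d) = mx3
  [:: [:: a ^+ 2 + b ^+ 2 - c ^+ 2 - d ^+ 2; 2 * (b * c - a * d);
          2 * (b * d + a * c)];
      [:: 2 * (b * c + a * d); a ^+ 2 - b ^+ 2 + c ^+ 2 - d ^+ 2;
          2 * (c * d - a * b)];
      [:: 2 * (b * d - a * c); 2 * (c * d + a * b);
          a ^+ 2 - b ^+ 2 - c ^+ 2 + d ^+ 2]].
Proof.
pose simp := (mulr0, mulr1, addr0, add0r, subr0, sub0r, oppr0).
apply: eq_mx3; rewrite [in LHS]mxE quat_imE im_delta !(qmul_row4, qconj_row4)
  row4E !simp [in RHS]mxE/=; ring.
Qed.

Lemma rotation_of_orthogonal q : sphere3 R q ->
  rotation_of q *m (rotation_of q)^T = 1%:M.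
Proof.
have [a [b [c [d ->]]]] := row4P q; rewrite /sphere3/= dot4E !row4E => q1.
have n2 : (a * a + b * b + c * c + d * d) ^+ 2 = 1 by rewrite q1 expr1n.
rewrite rotation_ofE; apply: eq_mx3; rewrite mulmx33E [in RHS]mxE !mxE/=.

(* As polynomials, $R_qR_q^T=|q|^4I$: on the diagonal 1 is replaced by $|q|^4$, and the off-diagonal
   entries vanish identically. *)
1,5,9: rewrite -[RHS]n2.
all: ring.
Qed.

Lemma det_rotation_of q : sphere3 R q -> \det (rotation_of q) = 1.
Proof.
have [a [b [c [d ->]]]] := row4P q; rewrite /sphere3/= dot4E !row4E => q1.
(* As a polynomial, $\det R_q=|q|^6$. *)
have n3 : (a * a + b * b + c * c + d * d) ^+ 3 = 1 by rewrite q1 expr1n.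
by rewrite rotation_ofE det33E !mxE/= -[RHS]n3; ring.
Qed.

(* [ad2 v, D], as [ad2 v] is skew-symmetric; see [bracketDE]. *)
Definition bracketD (r : R) (v : 'rV[R]_4) : 'M[R]_3 :=
  (2 * r) *: mx3 [:: [:: 0; 2 * v 0 3; - v 0 2]; [:: 2 * v 0 3; 0; - v 0 1];
                     [:: - v 0 2; - v 0 1; 0]].

(* [ad2 v] is the matrix of x |-> v x - x v on Im H. *)
Definition ad2 (v : 'rV[R]_4) : 'M[R]_3 :=
  2 *: mx3 [:: [:: 0; - v 0 3; v 0 2]; [:: v 0 3; 0; - v 0 1];
               [:: - v 0 2; v 0 1; 0]].

(** The product rule applied to $qx\bar q$ in the direction $u$, with one basis vector $x$ per
    column. *)
Definition drotation_of q u : 'M[R]_3 := \matrix_(i < 3, j < 3)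
  quat_im (qmul (qmul u (im_quat (delta_mx j 0))) (qconj q)
         + qmul (qmul q (im_quat (delta_mx j 0))) (qconj u)) i 0.

(* q v x qbar + q x vbar qbar = q (v x - x v) qbar for imaginary v. *)
Lemma drotation_of_qmul q v : v 0 0 = 0 ->
  drotation_of q (qmul q v) = rotation_of q *m ad2 v.
Proof.
have [v0 [x [y [z ->]]]] := row4P v; rewrite row4E => ->.
have [a [b [c [d ->]]]] := row4P q; rewrite rotation_ofE.
pose simp := (mulr0, mulr1, addr0, add0r, subr0, sub0r, oppr0).
apply: eq_mx3; rewrite mulmx33E [in LHS]mxE quat_imE im_delta
  !(qmul_row4, qconj_row4) row4D !row4E !simp ![in RHS]mxE/=; ring.
Qed.

(** The right-hand side has the shape that the product rule for $RDR^T$ produces. *)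
Lemma bracketDE r v : bracketD r v = ad2 v *m Dmx r + Dmx r *m (ad2 v)^T.
Proof.
apply: eq_mx3; rewrite [in RHS]mxE !mulmx33E !mxE/=; ring.
Qed.

(** Entry $(i,j)$ of the commutator is that of [ad2 v] times $D_j-D_i$. The gap is $2r$ in absolute
    value between the first two axes and $r$ for the other pairs, whence the weight $4=2^2$ on the
    k-component. *)
Lemma tr_bracketD r v w : \tr (bracketD r v *m bracketD r w) =
  8 * r ^+ 2 * (v 0 1 * w 0 1 + v 0 2 * w 0 2 + 4 * (v 0 3 * w 0 3)).
Proof. by rewrite mxtrace33E !mulmx33E !mxE/=; ring. Qed.

End Quaternions.

(** * Tangent spaces of the sphere and differentials along curves *)

Section Tangents.
Context {R : realType}.
Implicit Types (p q u v w : 'rV[R]_4).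

Lemma is_derive_dot4 (V : normedModType R) (f g : V -> 'rV[R]_4) t e
    (df dg : 'rV[R]_4) : is_derive t e f df -> is_derive t e g dg ->
  is_derive t e (fun x => dot4 (f x) (g x) : R^o)
    (dot4 df (g t) + dot4 (f t) dg).
Proof.
move=> Hf Hg; rewrite /dot4 -big_split/=.
apply: (@is_derive_big _ _ _ R^o) => l.
by apply: is_derive_mul; exact: is_derive_coord.
Qed.

Lemma is_Ck_dot4 (V : normedModType R) k (U : set V) (f g : V -> 'rV[R]_4) :
  open U -> is_Ck k U f -> is_Ck k U g ->
  is_Ck (W := R^o) k U (fun x => dot4 (f x) (g x)).
Proof.
move=> oU cf cg; apply: (@is_Ck_sum _ _ R^o) => // l.
by apply: is_CkM => //; exact: is_Ck_coord.
Qed.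

(** Differentiating $\langle c,c\rangle=1$ at 0 gives $2\langle p,u\rangle=0$. *)
Lemma tangent_orthogonal p u : tangent (sphere3 R) p u -> dot4 p u = 0.
Proof.
move=> [c [[I [[oI I0] _ cI]] [c0 dc]]].
have /(_ (fun _ => 1 : R^o)) := near_eq_is_derive _ (is_derive_dot4 dc dc).
have near1 : \forall t \near (0 : R^o), dot4 (c t) (c t) = 1.
  exact: (open_near_eq oI I0 (fun t It => cI t It)).
move=> /(_ near1)[_]; rewrite derive_cst c0 (dot4C u p) => /esym/eqP.
by rewrite -mulr2n mulrn_eq0/= => /eqP.
Qed.

(** [is_Ck] asks for derivatives in every direction [v] of the line, whereas calculus rules give
    direction 1. *)
Lemma is_derive_R (f : R^o -> R^o) (t v a : R) :
  is_derive (t : R^o) (1 : R^o) f a -> is_derive (t : R^o) (v : R^o) f (v * a).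
Proof.
move=> [/derivable1_diffP df <-]; apply: DeriveDef; first exact: diff_derivable.
by rewrite !deriveE// -[in LHS](mulr1 v) [LHS]linearZ.
Qed.

Lemma derive_trig k a b (t v : R) : is_derive (t : R^o) v
  (fun t => a * cos (k * t) + b * sin (k * t) : R^o)
  (v * (- a * k * sin (k * t) + b * k * cos (k * t))).
Proof.
apply: is_derive_R.
have dk : is_derive t 1 (fun t => k * t : R) k.
  apply: (is_derive_eq (is_deriveZ k (is_derive_id t 1))).
  by rewrite [LHS]mulr1.
have dcos := is_derive1_comp (is_derive_cos (k * t)) dk.
have dsin := is_derive1_comp (is_derive_sin (k * t)) dk.
have := is_deriveD (is_deriveZ a dcos) (is_deriveZ b dsin).
by move/is_derive_eq; apply; rewrite /GRing.scale/=; ring.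
Qed.

(** This family is closed under differentiation, so the induction runs over all coefficients [a] and
    [b]. *)
Lemma is_Ck_trig n (U : set R^o) k a b : is_Ck (V := R^o) (W := R^o) n U
  (fun t => a * cos (k * t) + b * sin (k * t)).
Proof.
elim: n a b => [|n IH] a b.
  move=> t _; apply: differentiable_continuous.
  by apply/derivable1_diffP; have [] := derive_trig k a b t 1.
split=> [t _|v].
  by apply/derivable1_diffP; have [] := derive_trig k a b t 1.
rewrite (_ : 'D_v _ = fun t =>
  v * b * k * cos (k * t) + v * - a * k * sin (k * t)).
  exact: IH.
by apply/funext => t; have [_ ->] := derive_trig k a b t v; ring.
Qed.

(** Together with the converse, this identifies the curve-based tangent space with $p^\perp$, which
    makes its linear structure available. *)
Lemma orthogonal_tangent p u :
  sphere3 R p -> dot4 p u = 0 -> tangent (sphere3 R) p u.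
Proof.
(* The zero vector is treated apart, with a constant curve, because the great circle divides by the
   speed. *)
move=> p1 pu; have [->|u0] := eqVneq u 0.
  exists (cst p); split; last by split=> //; exact: is_derive_cst.
  exists setT; split=> //; first by split=> //; exact: openT.
  by move=> k; exact: is_Ck_cst.
(* Great circle with initial velocity u. *)
pose k := Num.sqrt (dot4 u u).
have k0 : k != 0 by rewrite gt_eqF// sqrtr_gt0 dot4_gt0.
have k2 : k ^+ 2 = dot4 u u by rewrite sqr_sqrtr// ltW// dot4_gt0.
pose c (t : R^o) : 'rV[R]_4 := cos (k * t) *: p + sin (k * t) *: (k^-1 *: u).
have cE t i j : c t i j = p i j * cos (k * t) + k^-1 * u i j * sin (k * t).
  by rewrite !mxE; ring.
exists c; split; [|split].
- exists setT; split; first by split=> //; exact: openT.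
    move=> n; apply: is_Ck_mx => [|i j]; first exact: openT.
    rewrite (_ : (fun _ => _) = fun t =>
      p i j * cos (k * t) + k^-1 * u i j * sin (k * t)).
      exact: is_Ck_trig.
    by apply/funext => t; exact: cE.
  move=> t _; rewrite /sphere3/= /c scalerA dot4_sqr p1 pu -k2.
  by rewrite -[RHS](cos2Dsin2 (k * t)); field.
- by rewrite /c mulr0 cos0 sin0 scale1r scale0r addr0.
- apply: is_derive_mx => i j; rewrite (_ : (fun _ => _) = fun t =>
      p i j * cos (k * t) + k^-1 * u i j * sin (k * t) : R^o).
    apply: (is_derive_eq (derive_trig k (p i j) (k^-1 * u i j) 0 1)).
    by rewrite mulr0 cos0 sin0; field.
  by apply/funext => t; exact: cE.
Qed.

(** [tangent_map] chooses a value with default 0. Tangency of [v] supplies a curve, which excludes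
    the default, and uniqueness of derivatives fixes the choice. *)
Lemma tangent_map_eq (V W : normedModType R) (M : set V) (F : V -> W)
    (p v : V) (w : W) :
  tangent M p v ->
  (forall c, curve_through M p v c -> is_derive (0 : R^o) 1 (F \o c) w) ->
  tangent_map M F p v = w.
Proof.
move=> [c Hc] H; rewrite /tangent_map.
case: xgetP => [y -> [c' Hc' [_ <-]]|/(_ w) []].
  by have [_ ->] := H _ Hc'.
by exists c => //; exact: H.
Qed.

(** Smoothness of [F] enters only through its effect on curves, so no general chain rule for $C^k$
    maps is required. *)
Lemma tangent_comp (V W : normedModType R) (M : set V) (N : set W) (F : V -> W)
    (p v : V) (w : W) : set_fun M N F ->
  (forall k (U : set R^o) c, open U -> is_Ck k U c -> is_Ck k U (F \o c)) ->
  (forall c, curve_through M p v c -> is_derive (0 : R^o) 1 (F \o c) w) ->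
  tangent M p v -> tangent N (F p) w.
Proof.
move=> FMN cF dF [c Hc]; exists (F \o c); have := dF _ Hc.
move: Hc => [[I [[oI I0] Ic cI]] [c0 dc]] dFc; split; last first.
  by rewrite /= c0.
exists I; split=> // [k|t It]; first exact: cF.
exact/FMN/cI.
Qed.

End Tangents.

(** * Smoothness and derivatives of the quaternionic maps *)

Section SmoothQuaternions.
Context {R : realType} {V : normedModType R}.
Implicit Types (f g : V -> 'rV[R]_4) (df dg : 'rV[R]_4).

(** Here and below the arguments are functions on an arbitrary normed space: the statements nest,
    and they apply both to curves and to the identity of the ambient space. *)
Lemma is_Ck_row4 n (U : set V) (a b c d : V -> R^o) : open U ->
  is_Ck n U a -> is_Ck n U b -> is_Ck n U c -> is_Ck n U d ->
  is_Ck n U (fun x => row4 (a x) (b x) (c x) (d x)).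
Proof.
move=> oU ca cb cc cd; apply: is_Ck_mx => // i j; rewrite (ord1 i).
by elim/forall_ord4: j; under eq_fun do rewrite row4E.
Qed.

Lemma is_derive_row4 (a b c d : V -> R^o) t e (da db dc dd : R) :
  is_derive t e a da -> is_derive t e b db ->
  is_derive t e c dc -> is_derive t e d dd ->
  is_derive t e (fun x => row4 (a x) (b x) (c x) (d x)) (row4 da db dc dd).
Proof.
move=> ca cb cc cd; apply: is_derive_mx => // i j; rewrite (ord1 i).
by elim/forall_ord4: j; rewrite row4E; under eq_fun do rewrite row4E.
Qed.

Lemma is_Ck_qmul n (U : set V) f g : open U ->
  is_Ck n U f -> is_Ck n U g -> is_Ck n U (fun x => qmul (f x) (g x)).
Proof.
move=> oU cf cg; have cfi i := is_Ck_coord 0 i oU cf.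
have cgi i := is_Ck_coord 0 i oU cg.
by apply: is_Ck_row4 => //; do ![apply: is_CkD => // | apply: is_CkM => // |
  apply: is_CkN => //].
Qed.

Lemma is_derive_qmul f g t e df dg :
  is_derive t e f df -> is_derive t e g dg ->
  is_derive t e (fun x => qmul (f x) (g x)) (qmul df (g t) + qmul (f t) dg).
Proof.
move=> Hf Hg; have Hfi i := is_derive_coord 0 i Hf.
have Hgi i := is_derive_coord 0 i Hg.
apply: is_derive_eq.
  by apply: is_derive_row4;
     do ![apply: is_deriveD | apply: is_deriveB | apply: is_derive_mul].
by rewrite /qmul row4D; congr row4; rewrite /GRing.scale/=; ring.
Qed.

Lemma is_Ck_qconj n (U : set V) f : open U ->
  is_Ck n U f -> is_Ck n U (fun x => qconj (f x)).
Proof.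
move=> oU cf; have cfi i := is_Ck_coord 0 i oU cf.
by apply: is_Ck_row4 => //; apply: is_CkN.
Qed.

Lemma is_derive_qconj f t e df :
  is_derive t e f df -> is_derive t e (fun x => qconj (f x)) (qconj df).
Proof.
move=> Hf; have Hfi i := is_derive_coord 0 i Hf.
by apply: is_derive_row4 => //; apply: is_deriveN.
Qed.

Lemma is_Ck_quat_im n (U : set V) f : open U ->
  is_Ck n U f -> is_Ck n U (fun x => quat_im (f x)).
Proof.
move=> oU cf; apply: is_Ck_mx => // i j; rewrite (ord1 j).
by elim/forall_ord3: i; under eq_fun do rewrite quat_imE;
  exact: is_Ck_coord.
Qed.

Lemma is_derive_quat_im f t e df :
  is_derive t e f df -> is_derive t e (fun x => quat_im (f x)) (quat_im df).
Proof.
move=> Hf; apply: is_derive_mx => i j; rewrite (ord1 j).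
by elim/forall_ord3: i; rewrite quat_imE;
  under eq_fun do rewrite quat_imE; exact: is_derive_coord.
Qed.

Lemma is_Ck_rotation_of n (U : set V) f : open U ->
  is_Ck n U f -> is_Ck n U (fun x => rotation_of (f x)).
Proof.
move=> oU cf; apply: is_Ck_mx => // i j; under eq_fun do rewrite mxE.
apply: is_Ck_coord => //; apply: is_Ck_quat_im => //; apply: is_Ck_qmul => //.
  by apply: is_Ck_qmul => //; exact: is_Ck_cst.
exact: is_Ck_qconj.
Qed.

Lemma is_derive_rotation_of f t e df : is_derive t e f df ->
  is_derive t e (fun x => rotation_of (f x)) (drotation_of (f t) df).
Proof.
move=> Hf; apply: is_derive_mx => i j; rewrite mxE.
under eq_fun do rewrite mxE.
apply: is_derive_coord; apply: is_derive_quat_im.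
have He := is_derive_cst (im_quat (delta_mx j 0) : 'rV[R]_4) t e.
apply: (is_derive_eq (is_derive_qmul (is_derive_qmul Hf He)
  (is_derive_qconj Hf))).
(* The basis vector is constant, so the product rule leaves a term $q\cdot0$ to discard. *)
congr (qmul _ _ + _); rewrite {2}/qmul !mxE !mulr0 !addr0 !subr0.
by apply/rowP; apply: forall_ord4; rewrite !mxE/= addr0.
Qed.

Lemma is_Ck_Pmap r n (U : set V) f : open U ->
  is_Ck n U f -> is_Ck n U (fun x => Pmap r (f x)).
Proof.
move=> oU cf; apply: is_Ck_mulmx => //.
  apply: is_Ck_mulmx => //; first exact: is_Ck_rotation_of.
  exact: is_Ck_cst.
by apply: is_Ck_trmx => //; exact: is_Ck_rotation_of.
Qed.

End SmoothQuaternions.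

(** * The differential of [Pmap] and the pullback of the Frobenius metric *)

Section PullbackP.
Context {R : realType}.
Implicit Types (p q u v w : 'rV[R]_4).

(** For unit $q$, the vector $v=\bar qu$ is $u$ translated back to the identity, so that $u=qv$. *)
Definition dPmap (r : R) q u : 'M[R]_3 := rotation_of q *m
  bracketD r (qmul (qconj q) u) *m (rotation_of q)^T.

Lemma qmul_qconjK q u : sphere3 R q -> qmul q (qmul (qconj q) u) = u.
Proof.
have [a [b [c [d ->]]]] := row4P q; have [x [y [z [s ->]]]] := row4P u.
rewrite /sphere3/= dot4E !row4E => q1.
(* Each target coordinate is multiplied by $|q|^2=1$, which turns the goals into polynomial
   identities. *)
rewrite qconj_row4 !qmul_row4; congr row4; rewrite -[RHS]mul1r -q1; ring.
Qed.

(** Hence $\bar qu$ is imaginary exactly when $u$ is orthogonal to $q$. *)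
Lemma re_qconj_mul q u : qmul (qconj q) u 0 0 = dot4 q u.
Proof. by rewrite dot4E /qmul /qconj !row4E; ring. Qed.

(** Polarized four-square identity: left translation by a unit quaternion is an isometry. *)
Lemma dot4_qmul q v w : dot4 (qmul q v) (qmul q w) = dot4 q q * dot4 v w.
Proof.
have [a [b [c [d ->]]]] := row4P q; have [x [y [z [s ->]]]] := row4P v.
have [x' [y' [z' [s' ->]]]] := row4P w.
by rewrite !qmul_row4 !dot4E !row4E; ring.
Qed.

Lemma is_derive_Pmap r (V : normedModType R) (f : V -> 'rV[R]_4) t e
    (df : 'rV[R]_4) : sphere3 R (f t) -> dot4 (f t) df = 0 ->
  is_derive t e f df ->
  is_derive t e (fun x => Pmap r (f x)) (dPmap r (f t) df).
Proof.
move=> ft1 fdf Hf; have HR := is_derive_rotation_of Hf.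
apply: (is_derive_eq (is_derive_mulmx
  (is_derive_mulmx HR (is_derive_cst (Dmx r) t e)) (is_derive_trmx HR))).
(* Only the two copies of [df] inside [drotation_of] are rewritten as $q(\bar q\,df)$, to expose the
   factor [ad2]. *)
rewrite mulmx0 addr0 -{1 2}(qmul_qconjK df ft1).
rewrite drotation_of_qmul ?re_qconj_mul//.
by rewrite /dPmap bracketDE mulmxDr mulmxDl trmx_mul !mulmxA.
Qed.

(** The left-invariant field with value k at the identity. *)
Definition right_k q := qmul q (row4 0 0 0 1).

Lemma Pmap_Nb r q : sphere3 R q -> Nb r (Pmap r q).
Proof.
move=> q1; exists (rotation_of q) => //; split.
  exact: rotation_of_orthogonal.
exact: det_rotation_of.
Qed.

Lemma Pmap_curve r p u c : curve_through (sphere3 R) p u c ->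
  is_derive (0 : R^o) 1 (Pmap r \o c) (dPmap r p u).
Proof.
move=> Hc; have pu : tangent (sphere3 R) p u by exists c.
move: Hc => [[I [[_ I0] _ cI]] [c0 dc]].
rewrite -c0; apply: is_derive_Pmap => //; first exact: cI.
by rewrite c0; exact: tangent_orthogonal.
Qed.

(** Orthogonality of $R_p$ and cyclicity of the trace reduce to [tr_bracketD]. Left translation then
    turns the k-component of $\bar pu$ into $\langle u,pk\rangle$, and the weight 4 splits as
    $1+3$. *)
Lemma tr_dPmap r p u w : sphere3 R p -> dot4 p u = 0 -> dot4 p w = 0 ->
  \tr (dPmap r p u *m dPmap r p w) = 8 * r ^+ 2 *
    (dot4 u w + 3 * dot4 u (right_k p) * dot4 w (right_k p)).
Proof.
move=> p1 pu pw; rewrite /dPmap.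
have RTR := mulmx1C (rotation_of_orthogonal p1).
rewrite -!mulmxA mxtrace_mulC !mulmxA -[_ *m rotation_of p]mulmxA RTR mulmx1.
rewrite -[_ *m (rotation_of p)^T *m _]mulmxA RTR mulmx1 tr_bracketD.
set v := qmul _ u; set v' := qmul _ w.
have uw : dot4 u w = dot4 v v'.
  by rewrite -(qmul_qconjK u p1) -(qmul_qconjK w p1) dot4_qmul p1 mul1r.
have dk x : dot4 x (right_k p) = qmul (qconj p) x 0 3.
  rewrite -{1}(qmul_qconjK x p1) dot4_qmul p1 mul1r dot4E !row4E.
  by rewrite !mulr0 mulr1 !add0r.
(* The real part of [v] is $\langle p,u\rangle=0$, so the inner product reduces to the three
   imaginary components. *)
by rewrite !dk uw -/v -/v' dot4E {1}/v re_qconj_mul pu; ring.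
Qed.

Lemma pullback_Pmap r p u w : sphere3 R p ->
  tangent (sphere3 R) p u -> tangent (sphere3 R) p w ->
  pullback (sphere3 R) (Pmap r) (frobenius_metric r) p u w =
    8 * r ^+ 2 * (dot4 u w + 3 * dot4 u (right_k p) * dot4 w (right_k p)).
Proof.
move=> p1 tu tw.
have dP x : tangent (sphere3 R) p x ->
    tangent_map (sphere3 R) (Pmap r) p x = dPmap r p x /\
    tangent (Nb r) (Pmap r p) (dPmap r p x).
  move=> tx; split; first by apply: tangent_map_eq => // c; exact: Pmap_curve.
  apply: (tangent_comp (M := sphere3 R)) tx => [q|k U c oU|c].
  - exact: Pmap_Nb.
  - exact: is_Ck_Pmap.
  - exact: Pmap_curve.
rewrite /pullback (dP _ tu).1 (dP _ tw).1 /frobenius_metric /induced_form.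
(* The induced form is not at its default 0, since both image vectors are tangent to [Nb r]. *)
rewrite asboolT; last first.
  by split; [exact: Pmap_Nb|exact: (dP _ tu).2|exact: (dP _ tw).2].
by rewrite tr_dPmap//; exact: tangent_orthogonal.
Qed.

End PullbackP.

(** * The coordinate swap, the Berger metric and Riemannian metrics on the sphere *)

Section Swap.
Context {R : realType}.
Implicit Types (p q u v w : 'rV[R]_4).

Definition swap24 q := row4 (q 0 0) (q 0 3) (q 0 2) (q 0 1).

Lemma swap24K : involutive swap24.
Proof. by move=> q; rewrite /swap24 !row4E -row4_eta. Qed.

Lemma dot4_swap24 u w : dot4 (swap24 u) (swap24 w) = dot4 u w.
Proof. by rewrite !dot4E !row4E; ring. Qed.

(** For $q=(a,b,c,d)$ one has $qk=(-d,c,-b,a)$, and both sides equal $(-d,a,-b,c)$. *)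
Lemma hopf_swap24 q : hopf_field (swap24 q) = swap24 (right_k q).
Proof.
have [a [b [c [d ->]]]] := row4P q.
rewrite /right_k qmul_row4 /swap24 !row4E /hopf_field !row4E.
by congr row4; ring.
Qed.

Lemma is_Ck_swap24 (V : normedModType R) n (U : set V) f : open U ->
  is_Ck n U f -> is_Ck n U (fun x => swap24 (f x)).
Proof.
move=> oU cf; have cfi i := is_Ck_coord 0 i oU cf; exact: is_Ck_row4.
Qed.

Lemma swap24_sphere q : sphere3 R q -> sphere3 R (swap24 q).
Proof. by rewrite /sphere3/= dot4_swap24. Qed.

Lemma smooth_map_swap24 : smooth_map (sphere3 R) (sphere3 R) swap24.
Proof.
split=> [q|p p1]; first exact: swap24_sphere.
exists setT, swap24; split=> //; first by split=> //; exact: openT.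
by move=> k; apply: (is_Ck_swap24 openT); exact: is_Ck_id.
Qed.

Lemma diffeomorphism_swap24 : diffeomorphism (sphere3 R) (sphere3 R) swap24.
Proof.
split; first exact: smooth_map_swap24.
exists swap24; split; first exact: smooth_map_swap24.
- by move=> q _; exact: swap24K.
- by move=> q _; exact: swap24K.
Qed.

(** The Hopf vector must itself be shown tangent, as otherwise [round_metric] would return its
    default 0 on it. *)
Lemma berger_metricE p u w : sphere3 R p ->
  tangent (sphere3 R) p u -> tangent (sphere3 R) p w ->
  berger_metric R p u w =
    dot4 u w + 3 * dot4 u (hopf_field p) * dot4 w (hopf_field p).
Proof.
move=> p1 tu tw; have th : tangent (sphere3 R) p (hopf_field p).
  by apply: orthogonal_tangent => //; rewrite dot4E !row4E; ring.
by rewrite /berger_metric /round_metric /induced_form !asboolT.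
Qed.

(** The swap is linear, hence its own differential, and isometric. With [hopf_swap24] this yields
    the same closed formula as [pullback_Pmap], for $a=8r^2$. *)
Lemma pullback_swap24 a p u w : sphere3 R p ->
  tangent (sphere3 R) p u -> tangent (sphere3 R) p w ->
  pullback (sphere3 R) swap24 (scale_form a (berger_metric R)) p u w =
    a * (dot4 u w + 3 * dot4 u (right_k p) * dot4 w (right_k p)).
Proof.
move=> p1 tu tw.
have dT x : tangent (sphere3 R) p x ->
    tangent_map (sphere3 R) swap24 p x = swap24 x /\
    tangent (sphere3 R) (swap24 p) (swap24 x).
  move=> tx; split; last first.
    apply: orthogonal_tangent; first exact: swap24_sphere.
    by rewrite dot4_swap24; exact: tangent_orthogonal.
  apply: tangent_map_eq => // c [_ [_ dc]].
  by apply: is_derive_row4; exact: is_derive_coord.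
rewrite /pullback /scale_form (dT _ tu).1 (dT _ tw).1 berger_metricE.
- by rewrite hopf_swap24 !dot4_swap24.
- exact: swap24_sphere.
- exact: (dT _ tu).2.
- exact: (dT _ tw).2.
Qed.

(** Covers both metrics at once: [h] is [right_k] for the pullback by [Pmap] and [hopf_field] for
    the Berger metric. *)
Lemma riemannian_sphere3 (g : form_field 'rV[R]_4) a
    (h : 'rV[R]_4 -> 'rV[R]_4) :
  0 < a ->
  (forall p u w, sphere3 R p ->
    tangent (sphere3 R) p u -> tangent (sphere3 R) p w ->
    g p u w = a * (dot4 u w + 3 * dot4 u (h p) * dot4 w (h p))) ->
  is_Cinf setT h -> riemannian_metric (sphere3 R) g.
Proof.
move=> a0 gE ch; split.
- by move=> p u w p1 tu tw; rewrite !gE// (dot4C u w); ring.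
- move=> p b u v w p1 tu tv tw.
  have tuv : tangent (sphere3 R) p (b *: u + v).
    apply: orthogonal_tangent => //.
    by rewrite dot4Dr !tangent_orthogonal// mulr0 addr0.
  rewrite !gE// ![dot4 (_ + _) _]dot4C !dot4Dr !(dot4C w) !(dot4C (h p)).
  by ring.
(* The round term is positive and the correction is three times a square. *)
- move=> p u p1 tu u0; rewrite gE// mulr_gt0// ltr_pwDl ?dot4_gt0//.
  by rewrite -mulrA mulr_ge0// -expr2 sqr_ge0.
- move=> X Y [sX tX] [sY tY] p p1.
  have [U [F [oU cF FX]]] := sX p p1; have [U' [G [oU' cG GY]]] := sY p p1.
  (* The closed formula, fed with local smooth extensions of [X] and [Y], extends $g(X,Y)$ off the
     sphere. *)
  exists (U `&` U'), (fun q => a * (dot4 (F q) (G q) +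
    3 * dot4 (F q) (h q) * dot4 (G q) (h q))); split.
  + by split; [exact: openI oU.1 oU'.1|split; [exact: oU.2|exact: oU'.2]].
  + move=> k; have oI := openI oU.1 oU'.1.
    have cFI := is_Ck_subset (@subIsetl _ U U') (cF k).
    have cGI := is_Ck_subset (@subIsetr _ U U') (cG k).
    have chI := is_Ck_subset (@subsetT _ (U `&` U')) (ch k).
    have cst_ (b : R) : is_Ck (W := R^o) k (U `&` U') (fun=> b).
      exact: is_Ck_cst.
    apply: is_CkM => //; apply: is_CkD => //; first exact: is_Ck_dot4.
    by apply: is_CkM => //; [apply: is_CkM => //|]; exact: is_Ck_dot4.
  + move=> q q1 [Uq U'q]; rewrite gE//; [|exact: tX|exact: tY].
    by rewrite FX// GY.
Qed.

End Swap.

(** * Equality of the two pullbacks and the resulting isometry *)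

Theorem lemma2p8 (R : realType) (r : R) (hr : 0 < r) :
  (exists2 Theta : 'rV[R]_4 -> 'rV[R]_4,
     diffeomorphism (sphere3 R) (sphere3 R) Theta
     & eq_form_on (sphere3 R)
         (pullback (sphere3 R) (Pmap r) (frobenius_metric r))
         (pullback (sphere3 R) Theta (scale_form (8 * r ^+ 2) (berger_metric R))))
  /\ riemannian_isometric
       (sphere3 R) (pullback (sphere3 R) (Pmap r) (frobenius_metric r))
       (sphere3 R) (scale_form (8 * r ^+ 2) (berger_metric R)).
Proof.
have a0 : 0 < 8 * r ^+ 2 by rewrite mulr_gt0// exprn_gt0.
have H : eq_form_on (sphere3 R)
    (pullback (sphere3 R) (Pmap r) (frobenius_metric r))
    (pullback (sphere3 R) swap24 (scale_form (8 * r ^+ 2) (berger_metric R))).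
  by move=> p u w p1 tu tw; rewrite pullback_Pmap// pullback_swap24.
split; first by exists swap24 => //; exact: diffeomorphism_swap24.
split; last by exists swap24 => //; exact: diffeomorphism_swap24.
- apply: (riemannian_sphere3 (h := right_k)) a0 _ _ => [p u w|k].
    exact: pullback_Pmap.
  by apply: is_Ck_qmul; [exact: openT|exact: is_Ck_id|exact: is_Ck_cst].
- apply: (riemannian_sphere3 (h := @hopf_field R)) a0 _ _ => [p u w p1 tu tw|k].
    by rewrite /scale_form berger_metricE.
  have oT := @openT 'rV[R]_4.
  have ci i := is_Ck_coord 0 i oT (@is_Ck_id _ _ k setT).
  exact: is_Ck_row4 oT (is_CkN oT (ci 1)) (ci 0) (is_CkN oT (ci 3)) (ci 2).
Qed.
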